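(* Let $A$ be an atomic domain which has a nonzero finitely generated PS module. Then $A$ is a UFD.
   Context: All rings are commutative and unitary. An integral domain $A$ is atomic if every nonzero nonunit of $A$ is a finite product of irreducible elements (atoms). A torsion-free $A$-module $M$ is a PS module (pre-Schreier module) if every equality $ax=by$ with $a,b\in A-\{0\}$ and $x,y\in M-\{0\}$ has a refinement, i.e. there exist $c,d,e\in A$ and $z\in M$ with $a=ce$, $b=cd$, $x=dz$, $y=ez$. *)

(* Defs.v *)
From mathcomp Require Import all_boot all_algebra.

Set Implicit Arguments.
Unset Strict Implicit.
Unset Printing Implicit Defensive.

Import GRing.Theory.
Local Open Scope ring_scope.

Definition atom (A : idomainType) (p : A) : Prop :=
  [/\ p != 0, p \isn't a GRing.unit
    & forall a b : A, p = a * b ->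
        a \is a GRing.unit \/ b \is a GRing.unit].

Definition associates (A : idomainType) (a b : A) : Prop :=
  exists2 u : A, u \is a GRing.unit & b = u * a.

Definition atomic (A : idomainType) : Prop :=
  forall a : A, a != 0 -> a \isn't a GRing.unit ->
    exists2 s : seq A,
      (forall p, p \in s -> atom p) & a = \prod_(p <- s) p.

(* Factorizations into atoms exist and are unique up to order (the
   rearrangement t' of t) and associates. *)
Definition is_UFD (A : idomainType) : Prop :=
  atomic A /\
  forall s t : seq A,
    (forall p, p \in s -> atom p) -> (forall q, q \in t -> atom q) ->
    \prod_(p <- s) p = \prod_(q <- t) q ->
    exists t' : seq A,
      [/\ perm_eq t t', size s = size t'
        & forall i, (i < size s)%N -> associates s`_i t'`_i].

Definition nonzero_module (A : idomainType) (M : lmodType A) : Prop :=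
  exists x : M, x != 0.

Definition finitely_generated (A : idomainType) (M : lmodType A) : Prop :=
  exists (n : nat) (g : 'I_n -> M),
    forall x : M, exists c : 'I_n -> A, x = \sum_(i < n) c i *: g i.

Definition torsion_free (A : idomainType) (M : lmodType A) : Prop :=
  forall (a : A) (x : M), a *: x = 0 -> a = 0 \/ x = 0.

Definition PS_module (A : idomainType) (M : lmodType A) : Prop :=
  torsion_free M /\
  forall (a b : A) (x y : M),
    a != 0 -> b != 0 -> x != 0 -> y != 0 -> a *: x = b *: y ->
    exists (c d e : A) (z : M),
      [/\ a = c * e, b = c * d, x = d *: z & y = e *: z].

(* Main.v *)
(** Refining [a *: x = p *: y] for an atom [p] shows that [a *: x \in p M]
    forces [p %| a] or [x \in p M].  Hence if [p] divides [a * b] but neither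
    [a] nor [b], then [M = p M], and the determinant trick produces a unit
    multiple of [p], a contradiction.  So atoms are prime, and factorizations
    into atoms are unique. *)

Require Import Defs.
From mathcomp Require Import all_boot all_algebra.

Set Implicit Arguments.
Unset Strict Implicit.
Unset Printing Implicit Defensive.

Import GRing.Theory.
Local Open Scope ring_scope.

(** Divisibility in [A] and membership in [p M] are not decidable, so one cannot split on [P] at the
    outset. Finiteness of [I] lets an induction over its enumeration do without that. *)
Lemma or_forall_fin (I : finType) (P : Prop) (Q : I -> Prop) :
  (forall i, P \/ Q i) -> P \/ forall i, Q i.
Proof.
move=> PQ; suff [|Qs] : P \/ forall i, i \in enum I -> Q i; first by left.
  by right=> i; apply: Qs; rewrite mem_enum.
elim: (enum I) => [|i s [|Qs]]; [by right | by left |].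
have [|Qi] := PQ i; first by left.
by right=> j; rewrite inE => /orP[/eqP->|/Qs].
Qed.

Lemma det_1_sub_scale (R : comNzRingType) (n : nat) (p : R) (N : 'M[R]_n) :
  exists r, \det (1%:M - p *: N) = 1 - p * r.
Proof.
(* The determinant is the value at [p] of a polynomial with value [1] at 0. *)
pose D : {poly R} := \det (1%:M - 'X *: map_mx polyC N).
have DE x : D.[x] = \det (1%:M - x *: N).
  rewrite -[D.[x]]/(horner_eval x D) /D -det_map_mx; congr (\det _).
  apply/matrixP=> i j; rewrite !mxE rmorphB rmorphM rmorphMn rmorph1 /=.
  by rewrite /horner_eval hornerX hornerC.
have : D.[0] = 1 by rewrite DE scale0r subr0 det1.
(* For [D = q * 'X + c%:P], the value at 0 gives [c = 1], and the value at [p] is then [1 + q.[p] *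
   p]; hence [r = - q.[p]]. *)
rewrite -DE; elim/poly_ind: D {DE} => [|q c _].
  by rewrite !horner0 => ->; exists 0; rewrite mulr0 subr0.
rewrite !hornerE => ->; exists (- q.[p]).
by rewrite mulrN opprK addrC mulrC.
Qed.

(** Cramer's rule: combining the relations with coefficients from [\adj D] turns [D] into the scalar
    matrix of [\det D]. *)
Lemma det_annihilates (R : comNzRingType) (M : lmodType R) (n : nat)
    (D : 'M[R]_n) (g : 'I_n -> M) :
  (forall i, \sum_j D i j *: g j = 0) -> forall k, \det D *: g k = 0.
Proof.
move=> Dg0 k.
have -> : \det D *: g k = \sum_j (\adj D *m D) k j *: g j.
  rewrite mul_adj_mx (bigD1 k) //= big1 ?addr0 => [|j /negPf njk].
    by rewrite mxE eqxx.
  by rewrite mxE eq_sym njk scale0r.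
under eq_bigr => j _ do rewrite mxE scaler_suml.
rewrite exchange_big big1 //= => i _.
under eq_bigr => j _ do rewrite -scalerA.
by rewrite -scaler_sumr Dg0 scaler0.
Qed.

(** A Nakayama argument. Expanding each quotient [y] in the generators gives [g = p N g], so
    [\det (1 - p N)] kills [M]. As [M] is nonzero and torsion-free, this determinant [1 - p * r] is
    0. *)
Lemma divisible_fg_unit (A : idomainType) (M : lmodType A) (n : nat)
    (g : 'I_n -> M) (p : A) :
  torsion_free M -> nonzero_module M ->
  (forall x : M, exists c : 'I_n -> A, x = \sum_(i < n) c i *: g i) ->
  (forall i, exists y : M, g i = p *: y) -> p \is a GRing.unit.
Proof.
move=> tfM [x nzx] genM pg.
have /fin_all_exists[c gE] (i : 'I_n) :
    exists c : 'I_n -> A, g i = p *: \sum_j c j *: g j.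
  by have [y ->] := pg i; have [c ->] := genM y; exists c.
pose N : 'M[A]_n := \matrix_(i, j) c i j.
have Dg0 i : \sum_j (1%:M - p *: N) i j *: g j = 0.
  under eq_bigr => j _ do rewrite !mxE scalerBl -scalerA.
  rewrite sumrB -scaler_sumr -gE (bigD1 i) //= eqxx scale1r big1 ?addr0 ?subrr //.
  by move=> j /negPf nji; rewrite eq_sym nji scale0r.
have [r detE] := det_1_sub_scale p N.
have : \det (1%:M - p *: N) *: x = 0.
  have [d ->] := genM x; rewrite scaler_sumr big1 // => i _.
  by rewrite scalerA mulrC -scalerA det_annihilates ?scaler0.
move/tfM=> [|x0]; last by rewrite x0 eqxx in nzx.
rewrite detE => /eqP; rewrite subr_eq0 eq_sym => /eqP pr1.
by apply/unitrPr; exists r.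
Qed.

Lemma PS_atom_dvd (A : idomainType) (M : lmodType A) (p a : A) (x y : M) :
  PS_module M -> atom p -> a *: x = p *: y ->
  (exists k, a = p * k) \/ exists z : M, x = p *: z.
Proof.
move=> [tfM psM] [nzp _ irrp] axpy.
(* The PS property refines only equalities between nonzero data, so the degenerate cases are settled
   first. *)
have [->|nza] := eqVneq a 0; first by left; exists 0; rewrite mulr0.
have [->|nzx] := eqVneq x 0; first by right; exists 0; rewrite scaler0.
have nzy : y != 0.
  apply/eqP=> y0; move: axpy; rewrite y0 scaler0 => /tfM[] /eqP.
    by rewrite (negPf nza).
  by rewrite (negPf nzx).
have [c [d [e [z [aE pE xE _]]]]] := psM _ _ _ _ nza nzp nzx nzy axpy.
(* In [p = c * d], if [c] is a unit then [d] is associate to [p] and [x = d *: z] lies in [p M]; if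
   [d] is a unit then [c] is, and [a = c * e] is a multiple of [p]. *)
have [cU|dU] := irrp _ _ pE.
  by right; exists (c^-1 *: z); rewrite xE scalerA pE mulrAC divrr ?mul1r.
by left; exists (d^-1 * e); rewrite aE pE mulrA mulrK.
Qed.

Lemma PS_atom_prime (A : idomainType) (M : lmodType A) (p : A) :
  nonzero_module M -> finitely_generated M -> PS_module M -> atom p ->
  forall a b k, a * b = p * k ->
    (exists l, a = p * l) \/ exists l, b = p * l.
Proof.
move=> nzM [n [g genM]] psM atp a b k abE.
(* For each generator, [a *: (b *: g i) = p *: (k *: g i)]. *)
have := @or_forall_fin _ (exists l, a = p * l)
          (fun i => exists z : M, b *: g i = p *: z).
case=> [i||bg]; [|by left|].
  by apply: (@PS_atom_dvd _ _ _ _ _ (k *: g i)) => //; rewrite !scalerA abE.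
(* The same dichotomy, now for [b *: g i = p *: z], whose second outcome puts every generator in
   [p M]. *)
have := @or_forall_fin _ (exists l, b = p * l)
          (fun i => exists z : M, g i = p *: z).
case=> [i||pg]; [|by right|].
  by have [z bgE] := bg i; apply: PS_atom_dvd bgE.
by case: atp => _ /negP[]; apply: divisible_fg_unit pg => //; case: psM.
Qed.

Section PrimeAtoms.

Variable A : idomainType.
Hypothesis atom_prime : forall p : A, atom p -> forall a b k, a * b = p * k ->
  (exists l, a = p * l) \/ exists l, b = p * l.

Lemma atom_dvd_prod (p : A) (t : seq A) (k : A) :
  atom p -> \prod_(q <- t) q = p * k ->
  exists2 q, q \in t & exists l, q = p * l.
Proof.
move=> atp; elim: t k => [|q t IHt] k.
  rewrite big_nil => /esym pk1; case: atp => _ /negP[].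
  by apply/unitrPr; exists k.
rewrite big_cons => /(atom_prime atp)[qE|[l /IHt[r rt rE]]].
  by exists q; rewrite ?mem_head.
by exists r; rewrite // inE rt orbT.
Qed.

Lemma atom_dvd_associates (p q l : A) :
  atom p -> atom q -> q = p * l -> associates p q.
Proof.
move=> [_ /negP npU _] [_ _ irrq] qE; case: (irrq _ _ qE) => // lU.
by exists l; rewrite // mulrC.
Qed.

(** The unit [u] makes the induction on [s] go through: cancelling [p] against its associate
    [q = v * p] in [t] replaces [u] by [v^-1 * u]. *)
Lemma atom_factorization_unique (s t : seq A) (u : A) :
  (forall p, p \in s -> atom p) -> (forall q, q \in t -> atom q) ->
  u \is a GRing.unit -> u * \prod_(p <- s) p = \prod_(q <- t) q ->
  exists t' : seq A,
    [/\ perm_eq t t', size s = size t'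
      & forall i, (i < size s)%N -> associates s`_i t'`_i].
Proof.
elim: s t u => [|p s IHs] t u ats att uU.
  rewrite big_nil mulr1; case: t att => [|q t] att; first by exists [::].
  rewrite big_cons => uE; have [_ /negP nqU _] := att q (mem_head _ _).
  by case: nqU; move: uU; rewrite uE unitrM => /andP[].
rewrite big_cons => stE; have atp : atom p by apply: ats; rewrite mem_head.
have [q qt [l qE]] : exists2 q, q \in t & exists l, q = p * l.
  by apply: (@atom_dvd_prod _ _ (u * \prod_(r <- s) r)); rewrite // -stE mulrCA.
have [v vU qvp] := atom_dvd_associates atp (att q qt) qE.
have tq := perm_to_rem qt.
have [||||t' [tt' szt' asst']] := IHs (rem q t) (v^-1 * u).
- by move=> r rs; apply: ats; rewrite inE rs orbT.
- by move=> r /mem_rem /att.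
- by rewrite unitrM unitrV vU.
(* Multiplying both sides by [v * p], which is [q], restores the two original products. *)
- have [nzp _ _] := atp; apply: (mulfI nzp); apply: (mulrI vU).
  have tE : \prod_(r <- t) r = q * \prod_(r <- rem q t) r.
    by rewrite (perm_big _ tq) big_cons.
  rewrite [RHS]mulrA -qvp -tE -stE.
  by rewrite mulrCA -(mulrA v^-1) mulVKr // mulrCA.
exists (q :: t'); split=> [||[_|i /asst']] //=; last 1 first.
- by exists v.
- by rewrite (perm_trans tq) ?perm_cons.
- by rewrite szt'.
Qed.

End PrimeAtoms.

Theorem corollary2p13 (A : idomainType) (hA : atomic A)
    (hM : exists M : lmodType A,
        [/\ nonzero_module M, finitely_generated M & PS_module M]) :
  is_UFD A.
Proof.
split=> // s t ats att stE; have [M [nzM fgM psM]] := hM.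
apply: (@atom_factorization_unique _ _ s t 1); rewrite ?unitr1 ?mul1r //.
by move=> p; apply: PS_atom_prime nzM fgM psM.
Qed.
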